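(* Let $u,v\in\mathbb{R}$ with $0<u<v$. Then for every $q\ge1$, $$\left|A(u^{-1},v^{-1})-L^{-1}(u,v)\right|\le\frac{v-u}{2^{\frac{q-1}{q}+1}}\,A^{\frac1q}\left(|u|^{-2q},|v|^{-2q}\right).$$
   Context: For $u,v>0$: $A(u,v)=\frac{u+v}{2}$ is the arithmetic mean, and for $u\ne v$, $L(u,v)=\frac{v-u}{\log v-\log u}$ is the logarithmic mean. $L^{-1}(u,v)=1/L(u,v)$ and $A^{1/q}(a,b)=(A(a,b))^{1/q}$. *)

(* Defs.v *)
From Stdlib Require Import Reals.
Open Scope R_scope.

Definition amean (u v : R) : R := (u + v) / 2.

(* Logarithmic mean of distinct positive reals; it is only meant for
   0 < u, 0 < v and u <> v; on the diagonal the value is meaningless. *)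
Definition logmean (u v : R) : R := (v - u) / (ln v - ln u).

(* Main.v *)
Require Import Defs.
From Stdlib Require Import Reals Lra.
Open Scope R_scope.

(** The larger of the two derivative values [u^-2], [v^-2] carries the bound.
    Since [2^((q-1)/q+1) = 4 / 2^(1/q)], the factor [2^(1/q)] cancels the
    division by two in the mean, and the right-hand side is
    [(v - u) / 4 * (u^(-2q) + v^(-2q))^(1/q)]; an l^q norm dominates each of its
    entries, so this is at least [(v - u) / (4 u^2)].

    What remains is the crude trapezoid bound
    [|(1/u + 1/v)/2 - (ln v - ln u)/(v - u)| <= (v - u) / (4 u^2)].
    It is homogeneous of degree -1 in [(u, v)], so after multiplication by
    [v - u] it is an inequality in [t = v / u >= 1] alone:
    [|(t - 1/t)/2 - ln t| <= (t - 1)^2 / 4].  The bounds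
    [1 - 1/t <= ln t <= t - 1] are too weak for this near [t = 1], but applied to
    [s = sqrt t], with [ln t = 2 ln s], they suffice: both resulting
    inequalities are polynomial in [s] and vanish to third order at [s = 1]. *)

Lemma ln_le_sub1 (x : R) : 0 < x -> ln x <= x - 1.
Proof.
  intros hx.
  pose proof (exp_ineq1_le (ln x)) as h.
  rewrite exp_ln in h by assumption; lra.
Qed.

Lemma ln_ge_1_sub_inv (x : R) : 0 < x -> 1 - / x <= ln x.
Proof.
  intros hx.
  pose proof (ln_le_sub1 (/ x) (Rinv_0_lt_compat x hx)) as h.
  rewrite ln_Rinv in h by assumption; lra.
Qed.

(** The constant [1/4] is exactly what makes the second-order terms at [s = 1]
    cancel when [ln s] is replaced by [s - 1] or by [1 - 1/s]; the remaining cubic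
    factor [(s - 1)^3] has a cofactor that is positive for [s >= 1]. *)
Lemma sqr_sub_inv_sub_ln_bound (s : R) : 1 <= s ->
  Rabs ((s ^ 2 - / s ^ 2) / 2 - 2 * ln s) <= (s ^ 2 - 1) ^ 2 / 4.
Proof.
  intros hs.
  assert (hcube : 0 <= (s - 1) ^ 3) by (apply pow_le; lra).
  assert (hinv : 0 < / (4 * s ^ 2)) by (apply Rinv_0_lt_compat; nra).
  pose proof (ln_le_sub1 s ltac:(lra)) as hup.
  pose proof (ln_ge_1_sub_inv s ltac:(lra)) as hlo.
  apply Rabs_le; split.
  - assert (h : (s ^ 2 - 1) ^ 2 / 4 + (s ^ 2 - / s ^ 2) / 2 - 2 * (s - 1)
      = (s - 1) ^ 3 * (s ^ 3 + 3 * s ^ 2 + 6 * s + 2) * / (4 * s ^ 2))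
      by (field; lra).
    assert (0 <= (s - 1) ^ 3 * (s ^ 3 + 3 * s ^ 2 + 6 * s + 2) * / (4 * s ^ 2)).
    { apply Rmult_le_pos; [apply Rmult_le_pos|]; nra. }
    lra.
  - assert (h : (s ^ 2 - 1) ^ 2 / 4 - (s ^ 2 - / s ^ 2) / 2 + 2 * (1 - / s)
      = (s - 1) ^ 3 * (s ^ 3 + 3 * s ^ 2 + 2 * s - 2) * / (4 * s ^ 2))
      by (field; lra).
    assert (0 <= (s - 1) ^ 3 * (s ^ 3 + 3 * s ^ 2 + 2 * s - 2) * / (4 * s ^ 2)).
    { apply Rmult_le_pos; [apply Rmult_le_pos|]; nra. }
    lra.
Qed.

(** The trapezoid rule for [1/x] on [[u, v]], whose mean value there is
    [1 / logmean u v], with error controlled by the largest slope [u^-2]. *)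
Lemma amean_inv_sub_inv_logmean_bound (u v : R) : 0 < u -> u < v ->
  Rabs (amean (/ u) (/ v) - / logmean u v) <= (v - u) / 4 * / u ^ 2.
Proof.
  intros hu huv.
  assert (ht : 1 < v / u) by (apply (Rmult_lt_reg_r u); [|field_simplify]; lra).
  set (s := sqrt (v / u)).
  assert (hs2 : s ^ 2 = v / u) by (apply pow2_sqrt; lra).
  assert (hs : 1 <= s) by (rewrite <- sqrt_1; apply sqrt_le_1_alt; lra).
  assert (hln : 2 * ln s = ln v - ln u).
  { change 2 with (INR 2); rewrite <- ln_pow, hs2 by lra; unfold Rdiv.
    rewrite ln_mult, ln_Rinv by (assumption || lra || (apply Rinv_0_lt_compat; lra)); ring. }
  assert (hlt : ln u < ln v) by (apply ln_increasing; assumption).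
  replace (amean (/ u) (/ v) - / logmean u v)
    with (((s ^ 2 - / s ^ 2) / 2 - 2 * ln s) * / (v - u)).
  2:{ rewrite hln, hs2; unfold amean, logmean; field; lra. }
  rewrite Rabs_mult, (Rabs_pos_eq (/ (v - u)))
    by (apply Rlt_le, Rinv_0_lt_compat; lra).
  apply (Rle_trans _ ((s ^ 2 - 1) ^ 2 / 4 * / (v - u))).
  - apply Rmult_le_compat_r.
    + apply Rlt_le, Rinv_0_lt_compat; lra.
    + apply sqr_sub_inv_sub_ln_bound, hs.
  - rewrite hs2; right; field; lra.
Qed.

Lemma le_lq_norm (a b q : R) : 0 < a -> 0 < b -> 0 < q ->
  a <= Rpower (Rpower a q + Rpower b q) (/ q).
Proof.
  intros ha hb hq.
  rewrite <- (Rpower_1 a) at 1 by assumption.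
  rewrite <- (Rinv_r q), <- Rpower_mult by lra.
  pose proof (exp_pos (q * ln b)) as hbq; fold (Rpower b q) in hbq.
  apply Rle_Rpower_l.
  - apply Rlt_le, Rinv_0_lt_compat; assumption.
  - split; [apply exp_pos | lra].
Qed.

Lemma Rpower_neg_2_mul (x q : R) : 0 < x ->
  Rpower x (- 2 * q) = Rpower (/ x ^ 2) q.
Proof.
  intros hx.
  rewrite <- Rpower_mult; f_equal.
  replace (- 2) with (- INR 2) by (simpl; lra).
  rewrite Rpower_Ropp, Rpower_pow by assumption; reflexivity.
Qed.

Lemma Rpower_amean_div_Rpower2 (a b q : R) : 0 < a -> 0 < b -> 0 < q ->
  Rpower (amean a b) (1 / q) / Rpower 2 ((q - 1) / q + 1)
  = Rpower (a + b) (/ q) / 4.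
Proof.
  intros ha hb hq.
  replace (Rpower 2 ((q - 1) / q + 1)) with (4 * / Rpower 2 (/ q)).
  2:{ replace ((q - 1) / q + 1) with (INR 2 + - / q) by (simpl; field; lra).
      rewrite Rpower_plus, Rpower_Ropp, Rpower_pow by lra; ring. }
  replace (a + b) with (amean a b * 2) by (unfold amean; field).
  rewrite <- Rpower_mult_distr by (unfold amean; lra).
  replace (1 / q) with (/ q) by (field; lra).
  assert (0 < Rpower 2 (/ q)) by apply exp_pos.
  field; lra.
Qed.

Theorem proposition3 (u v : R) (hu : 0 < u) (huv : u < v) (q : R) (hq : 1 <= q) :
  Rabs (amean (/ u) (/ v) - / logmean u v)
  <= (v - u) / Rpower 2 ((q - 1) / q + 1)
     * Rpower (amean (Rpower (Rabs u) (- 2 * q)) (Rpower (Rabs v) (- 2 * q))) (1 / q).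
Proof.
  assert (hu2 : 0 < / u ^ 2) by (apply Rinv_0_lt_compat, pow_lt; lra).
  assert (hv2 : 0 < / v ^ 2) by (apply Rinv_0_lt_compat, pow_lt; lra).
  rewrite !Rabs_pos_eq with (x := u) by lra.
  rewrite !Rabs_pos_eq with (x := v) by lra.
  rewrite !Rpower_neg_2_mul by lra.
  unfold Rdiv at 1.
  rewrite Rmult_assoc, (Rmult_comm (/ Rpower 2 _)).
  change (Rpower ?m ?e * / ?d) with (Rpower m e / d).
  rewrite Rpower_amean_div_Rpower2 by (apply exp_pos || lra).
  pose proof (le_lq_norm (/ u ^ 2) (/ v ^ 2) q hu2 hv2 ltac:(lra)) as hnorm.
  pose proof (amean_inv_sub_inv_logmean_bound u v hu huv) as htrap.
  nra.
Qed.
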